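(* Let $n\ge 1$. Suppose that $\sigma = \sigma_1 \ldots \sigma_{2n+1} \in S_{2n+1}$ and the charge path $\mathrm{chpath}(\sigma)$ is a Dyck path of length $2n$. Then the $(2n+1)$-cycle $C_\sigma = (\sigma_1, \ldots, \sigma_{2n+1})$ is incontractible and $NT_{\mu}(C_\sigma) = n$.
   Context: Here $C_\sigma$ is the cyclic arrangement of $\{1,\dots,2n+1\}$ in which $\sigma_{i+1}$ immediately follows $\sigma_i$ and $\sigma_1$ immediately follows $\sigma_{2n+1}$. Charge path: for a permutation $\sigma=\sigma_1\ldots\sigma_m\in S_m$ in one-line notation, define the index $\mathrm{ind}_\sigma$ by $\mathrm{ind}_\sigma(1)=0$ and, inductively, $\mathrm{ind}_\sigma(i+1)=\mathrm{ind}_\sigma(i)$ if $i+1$ appears to the right of $i$ in $\sigma$, and $\mathrm{ind}_\sigma(i+1)=1+\mathrm{ind}_\sigma(i)$ if $i+1$ appears to the left of $i$ in $\sigma$. The charge path $\mathrm{chpath}(\sigma)$ is the path whose successive vertices are $(i-1,\mathrm{ind}_\sigma(\sigma_i))$ for $i=1,\dots,m$, with consecutive vertices joined by edges. A Dyck path of length $2n$ is a lattice path with steps $(1,1)$ and $(1,-1)$ from $(0,0)$ to $(2n,0)$ that never goes below the $x$-axis. Cycles: an $m$-cycle of $\{1,\dots,m\}$ is written $C=(c_0,\dots,c_{m-1})$ and read cyclically. We say $c_s$ is cyclically between $c_i$ and $c_j$ if $i<s<j$, or $j<i<s$, or $s<j<i$. For $a<b$, the pair $\langle a,b\rangle$ is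 an occurrence of $\mu$ in $C$ if there is no $x$ with $a<x<b$ that is cyclically between $a$ and $b$ in $C$; it is nontrivial if $a+1<b$. $NT_\mu(C)$ is the number of nontrivial occurrences of $\mu$ in $C$. The cycle $C$ is incontractible if there is no $i$ with $1\le i\le m-1$ such that $i+1$ immediately follows $i$ in $C$. *)

(* Defs.v *)
From mathcomp Require Import all_boot all_order all_fingroup all_algebra.

Set Implicit Arguments.
Unset Strict Implicit.
Unset Printing Implicit Defensive.

Import Order.TTheory GRing.Theory Num.Theory.

(* Elements of 'I_m are 0-based; the one-line word sigma_1 ... sigma_m uses the
   labels 1, ..., m.  The same word, read cyclically, is the m-cycle C_sigma. *)
Definition oneline m (s : 'S_m) : seq nat := [seq (s i).+1 | i <- enum 'I_m].

(* The values at i = 0 and at i > size w are junk. *)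
Fixpoint charge_index (w : seq nat) (i : nat) : nat :=
  if i is (j.+1 as k).+1 then
    if index k w < index k.+1 w then charge_index w k
    else (charge_index w k).+1
  else 0.

(* A lattice path is given by its list of successive vertices. *)
Definition chpath m (s : 'S_m) : seq (int * int) :=
  let w := oneline s in
  [seq (i%:Z%R, (charge_index w (nth 0 w i))%:Z%R) | i <- iota 0 m].

Definition dyck_step (u v : int * int) : bool :=
  ((v - u)%R == (1, 1)%R) || ((v - u)%R == (1, -1)%R).

(* The endpoints and the steps force a path of length 2n to have 2n+1
   vertices. *)
Definition dyck_path (n : nat) (p : seq (int * int)) : bool :=
  if p is v :: q then
    [&& v == (0, 0)%R, path dyck_step v q, last v q == (n.*2%:Z%R, 0%R)
      & all (fun u => 0 <= u.2)%R p]
  else false.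

(* Below, a cycle (c_0, ..., c_(m-1)) of {1, ..., m} is a duplicate-free word C
   with these entries; index x C is the subscript of x.  Note the argument
   order: cyc_between C a b x says that x is cyclically between a and b. *)
Definition cyc_between (C : seq nat) (a b x : nat) : bool :=
  let i := index a C in let j := index b C in let s := index x C in
  [|| i < s < j, (j < i) && (i < s) | (s < j) && (j < i)].

Definition mu_occ (C : seq nat) (a b : nat) : bool :=
  (a < b) && ~~ has (fun x => (a < x < b) && cyc_between C a b x) C.

Definition NTmu (C : seq nat) : nat :=
  count (fun p => mu_occ C p.1 p.2 && (p.1.+1 < p.2))
        [seq (a, b) | a <- C, b <- C].

Definition incontractible (C : seq nat) : Prop :=
  ~ exists i, 1 <= i <= (size C).-1 /\ next C i = i.+1.

(* Main.v *)
(** By construction the charge index is weakly increasing in the label, and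
    labels of equal index occur from left to right in increasing order.  On a
    Dyck path adjacent letters have indices differing by exactly 1, which rules
    out contractions, and indices of intermediate height cannot be skipped.
    Hence a nontrivial occurrence <a, b> of mu has ind b = ind a + 1 with b
    immediately to the right of a: if ind b = ind a or if b is to the left of a,
    then a + 1, or a letter of index ind a + 1, lies cyclically between them.
    So the nontrivial occurrences are the up-steps, of which there are n. *)

Require Import Defs.
From mathcomp Require Import all_boot all_order all_fingroup all_algebra.
From mathcomp Require Import zify.

Lemma charge_indexS w a : 0 < a ->
  charge_index w a.+1 = charge_index w a + (index a.+1 w <= index a w).
Proof. by case: a => //= a _; case: ltnP; rewrite ?addn0 ?addn1. Qed.

Lemma leq_charge_index w a b : a <= b -> charge_index w a <= charge_index w b.
Proof.
elim: b => [|b IHb]; first by rewrite leqn0 => /eqP->.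
rewrite leq_eqVlt ltnS => /predU1P[-> //|/IHb /leq_trans]; apply.
by case: b {IHb} => // b; rewrite (charge_indexS w b.+1) // leq_addr.
Qed.

Lemma charge_index_lt w a b :
  charge_index w a < charge_index w b -> a < b.
Proof. by rewrite !ltnNge; apply/contra/leq_charge_index. Qed.

(** By monotonicity all labels from [a] to [b] share one index, so each of them stands to the right
    of its predecessor. *)
Lemma charge_index_eq w a b : 0 < a < b ->
  charge_index w a = charge_index w b -> index a w < index b w.
Proof.
case/andP=> a0; elim: b => // b IHb; rewrite ltnS => ab Eab.
have b0 := leq_trans a0 ab; move: Eab; rewrite (charge_indexS w _ b0).
have:= leq_charge_index w _ _ ab;
  case: (leqP (index b.+1 w) (index b w)) => [_|ltb] leab Eab; first by lia.
have [->|nab] := eqVneq a b; first by [].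
by apply: (ltn_trans _ ltb); apply: IHb; lia.
Qed.

(** Bounding the upward jumps suffices: if [f j.+1] differs from [c] it exceeds [c], so [f j] is
    still at least [c]. *)
Lemma discrete_ivt (f : nat -> nat) i j c : i <= j ->
    (forall k, i <= k < j -> f k.+1 <= (f k).+1) -> f i <= c <= f j ->
  exists2 k, i <= k <= j & f k = c.
Proof.
elim: j => [|j IHj] leij step /andP[fi fj].
  by move: leij fi; rewrite leqn0 => /eqP-> fi; exists 0; lia.
have [fjc|nfjc] := eqVneq (f j.+1) c; first by exists j.+1; rewrite // leij leqnn.
have ltij : i <= j.
  by rewrite -ltnS ltn_neqAle leij andbT; apply/eqP=> E; move: fi; rewrite E; lia.
have stepj : f j.+1 <= (f j).+1 by apply: step; rewrite ltij ltnSn.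
have [||k Hk <-] := IHj ltij; last by exists k => //; lia.
  by move=> k Hk; apply: step; lia.
by lia.
Qed.

(** Down-steps are stated with a successor to avoid truncated subtraction. *)
Definition unit_steps (f : nat -> nat) (N : nat) : Prop :=
  forall i, i < N -> f i.+1 = (f i).+1 \/ f i = (f i.+1).+1.

(** An up-step adds 2 to [N + f N]; a down-step adds 1 - 1 = 0. *)
Lemma count_up_steps (f : nat -> nat) N : f 0 = 0 -> unit_steps f N ->
  (count (fun i => f i.+1 == (f i).+1) (iota 0 N)).*2 = N + f N.
Proof.
move=> f0; elim: N => [|N IHN] step; first by rewrite f0.
have {}IHN := IHN (fun i Hi => step i (ltnW Hi)).
rewrite -addn1 iotaD count_cat doubleD IHN add0n /= addn0 addn1.
by have:= step N (ltnSn N); case: eqP; lia.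
Qed.

(** For [w = oneline s], the ordinate of the charge path at abscissa [i]. *)
Definition height (w : seq nat) (i : nat) : nat := charge_index w (nth 0 w i).

Lemma height_index w a : a \in w -> height w (index a w) = charge_index w a.
Proof. by move=> wa; rewrite /height nth_index. Qed.

Section DyckWord.

Context (w : seq nat) (N : nat).
Hypothesis uniq_w : uniq w.
Hypothesis size_w : size w = N.+1.
Hypothesis mem_w : forall x, (x \in w) = (0 < x <= N.+1).
Hypothesis height0 : height w 0 = 0.
Hypothesis heightN : height w N = 0.
Hypothesis height_steps : unit_steps (height w) N.

Lemma dyck_word_incontractible : incontractible w.
Proof.
move=> [i []]; rewrite size_w => /= /andP[i0 iN].
have wi : i \in w by rewrite mem_w; lia.
have wi1 : i.+1 \in w by rewrite mem_w; lia.
have ltiw : index i w < N.+1 by rewrite -size_w index_mem.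
have hi := height_index w i wi; have hi1 := height_index w i.+1 wi1.
have hS := charge_indexS w i i0.
(* [next_nth] encodes the wrap-around by using the first letter as the default value of [nth]. *)
have -> : next w i = if index i w == N then nth 0 w 0 else nth 0 w (index i w).+1.
  rewrite next_nth wi; move: (index i w) ltiw size_w => k.
  case: (w) => //= y p ltkN [sp]; case: eqP => [->|nkN].
    by rewrite nth_default ?sp.
  by apply: set_nth_default; lia.
(* At the wrap-around [i.+1] comes first and [i] last, so the index would rise by 1, while both ends
   of the path have height 0. Elsewhere [i.+1] stands right of [i], so the two indices agree,
   against the unit step. *)
case: eqP => [iwN Ei1|niwN Ei1].
  have i1w : index i.+1 w = 0 by rewrite -Ei1 index_uniq // size_w.
  by move: hS hi hi1; rewrite i1w iwN height0 heightN; lia.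
have i1w : index i.+1 w = (index i w).+1 by rewrite -Ei1 index_uniq // size_w; lia.
have ltiN : index i w < N by lia.
by move: hS hi hi1; rewrite i1w; have := height_steps _ ltiN; lia.
Qed.

Lemma NTmu_occ_up_step a b : a \in w -> b \in w ->
  mu_occ w a b && (a.+1 < b) =
  (index b w == (index a w).+1)
  && (height w (index a w).+1 == (height w (index a w)).+1).
Proof.
move=> wa wb; have ha := height_index w a wa; have hb := height_index w b wb.
have lta : index a w < N.+1 by rewrite -size_w index_mem.
have ltb : index b w < N.+1 by rewrite -size_w index_mem.
have a0 : 0 < a by move: wa; rewrite mem_w => /andP[].
have bN : b <= N.+1 by move: wb; rewrite mem_w => /andP[].
apply/idP/idP; last first.
  case/andP=> /eqP Eb; rewrite -Eb ha hb => /eqP Eh.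
  have ltab : a < b by apply: (charge_index_lt w); rewrite Eh.
  rewrite /mu_occ ltab /=; apply/andP; split.
    by apply/hasPn=> x _; rewrite /cyc_between; lia.
  rewrite ltn_neqAle ltab andbT; apply/eqP=> Eab.
  by move: (charge_indexS w a a0); rewrite Eab Eh Eb; lia.
case/andP=> /andP[ltab /hasPn no_x] lta1b.
have wa1 : a.+1 \in w by rewrite mem_w; lia.
have ha1 := charge_indexS w a a0.
have no_between k : k <= N -> a < nth 0 w k < b ->
    ~~ [|| index a w < k < index b w,
           (index b w < index a w) && (index a w < k)
         | (k < index b w) && (index b w < index a w)].
  move=> kN Hk; have kw : k < size w by rewrite size_w.
  by have:= no_x _ (mem_nth 0 kw); rewrite Hk /cyc_between index_uniq.
have no_a1 := no_x _ wa1; rewrite /cyc_between leqnn lta1b /= in no_a1.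
have up_step k : k < N -> height w k.+1 <= (height w k).+1.
  by move/height_steps; lia.
have := leq_charge_index w _ _ (ltnW ltab).
have := leq_charge_index w _ _ (ltnW lta1b).
have neq_ab : index a w != index b w.
  by apply/eqP=> E; have:= ltnn b; rewrite -{1}(nth_index 0 wb) -E nth_index // ltab.
(* The index of [b] exceeds that of [a] by 0, by 1 or by at least 2. If by 0, then [a.+1] has the
   same index and stands between them. *)
have [Eh|nEh] := eqVneq (charge_index w b) (charge_index w a).
  move=> h1 h2.
  have := charge_index_eq w a a.+1; have := charge_index_eq w a.+1 b; lia.
move=> h1 h2; have [Eh|nEh1] := eqVneq (charge_index w b) (charge_index w a).+1.
  case: (ltnP (index a w) (index b w)) => [ltij|leji]; last first.
    (* With [b] left of [a], the letter [a.+1] stands right of [a] if it has the index of [a], and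
       left of [b] if it has that of [b]. *)
    have := charge_index_eq w a.+1 b; lia.
  suff Ei : index b w = (index a w).+1 by rewrite -Ei ha hb Eh !eqxx.
  apply/eqP; rewrite eqn_leq ltij andbT leqNgt; apply/negP=> lt1.
  have aN : index a w < N by lia.
  have wk : forall k, k <= N -> nth 0 w k \in w.
    by move=> k kN; apply: mem_nth; rewrite size_w.
  (* After an up-step from [a], the next letter has the index of [b] and stands left of [b], hence
     is smaller than [b]. *)
  have [Hu|Hd] := height_steps _ aN.
    set x := nth 0 w (index a w).+1.
    have hx : charge_index w x = charge_index w b by rewrite /x -/(height _ _) Hu ha.
    have ix : index x w = (index a w).+1 by rewrite index_uniq ?size_w.
    have x0 : 0 < x by have := wk _ aN; rewrite mem_w => /andP[].
    have ltax : a < x by apply: (charge_index_lt w); lia.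
    have ltxb : x < b.
      rewrite ltnNge leq_eqVlt; apply/negP=> /predU1P[E|ltbx].
        by move: ix lt1; rewrite -E; lia.
      by have := charge_index_eq w b x; lia.
    by have := no_between _ aN; rewrite -/x; lia.
  (* After a down-step the path regains the height of [a] before reaching [b]; the letter there
     stands right of [a], hence is larger than [a]. *)
  have [k Hk||k Hk hk] := discrete_ivt (height w) _ _ (charge_index w a) (ltnW lt1).
  - by apply: up_step; lia.
  - by lia.
  have kN : k <= N by lia.
  have kb : k != index b w by apply/eqP=> E; move: hk; rewrite E; lia.
  set x := nth 0 w k.
  have ix : index x w = k by rewrite index_uniq ?size_w.
  have x0 : 0 < x by have := wk _ kN; rewrite mem_w => /andP[].
  have ltxb : x < b by apply: (charge_index_lt w); rewrite -/(height w k); lia.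
  have ltax : a < x.
    rewrite ltnNge leq_eqVlt; apply/negP=> /predU1P[E|ltxa].
      by move: ix Hk; rewrite E; lia.
    by have := charge_index_eq w x a; rewrite /x -/(height w k) hk -/x; lia.
  by have := no_between _ kN; rewrite -/x; lia.
(* The gap is now at least 2. Climbing to [b] from [a], or from the start of the word if [b] is left
   of [a], the path meets the height just above that of [a]. *)
pose i := if index a w < index b w then index a w else 0.
have leib : i <= index b w by rewrite /i; case: ifP; lia.
have hi : height w i <= charge_index w a by rewrite /i; case: ifP; lia.
have [k Hk||k Hk hk] := discrete_ivt (height w) _ _ (charge_index w a).+1 leib.
- by apply: up_step; lia.
- by lia.
have kN : k <= N by lia.
have kb : k != index b w by apply/eqP=> E; move: hk; rewrite E; lia.
have ka : k != index a w by apply/eqP=> E; move: hk; rewrite E; lia.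
have ltxb : nth 0 w k < b by apply: (charge_index_lt w); rewrite -/(height w k); lia.
have ltax : a < nth 0 w k by apply: (charge_index_lt w); rewrite -/(height w k); lia.
have := no_between _ kN; rewrite ltax ltxb.
by move: Hk; rewrite /i; case: ifP; lia.
Qed.

(** The up-step at position [i] corresponds to the pair of letters at positions [i] and [i.+1]; as
    the path ends at height 0, half of its [N] steps go up. *)
Lemma NTmu_dyck_word : NTmu w = N./2.
Proof.
have := count_up_steps _ _ height0 height_steps; rewrite heightN addn0 => <-.
rewrite doubleK /NTmu -!size_filter.
rewrite -(size_map (fun i => (nth 0 w i, nth 0 w i.+1))).
apply/perm_size/uniq_perm.
- by apply: filter_uniq; apply: allpairs_uniq => // -[? ?] [? ?] _ _ [-> ->].
- rewrite map_inj_in_uniq ?filter_uniq ?iota_uniq // => i j.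
  rewrite !mem_filter !mem_iota => /andP[_ Hi] /andP[_ Hj] [/eqP].
  by rewrite nth_uniq ?size_w => [/eqP| | |] //; lia.
case=> a b; rewrite mem_filter; apply/andP/mapP.
  case=> /= occ /allpairsP[[a' b'] /= [wa wb [Ea Eb]]]; subst a' b'.
  move: occ; rewrite NTmu_occ_up_step // => /andP[/eqP Ei up].
  exists (index a w); last by rewrite -Ei !nth_index.
  by rewrite mem_filter up mem_iota /= add0n -ltnS -Ei -size_w index_mem.
case=> i; rewrite mem_filter mem_iota => /andP[up /andP[_ iN]] [-> ->].
have wi : nth 0 w i \in w by rewrite mem_nth // size_w; lia.
have wi1 : nth 0 w i.+1 \in w by rewrite mem_nth // size_w; lia.
split; last by apply/allpairsP; exists (nth 0 w i, nth 0 w i.+1).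
by rewrite /= NTmu_occ_up_step // !index_uniq ?size_w ?eqxx //; lia.
Qed.

End DyckWord.

Lemma size_oneline m (s : 'S_m) : size (oneline s) = m.
Proof. by rewrite size_map size_enum_ord. Qed.

Lemma oneline_uniq m (s : 'S_m) : uniq (oneline s).
Proof.
rewrite map_inj_uniq ?enum_uniq // => i j [/val_inj].
exact: perm_inj.
Qed.

Lemma mem_oneline m (s : 'S_m) x : (x \in oneline s) = (0 < x <= m).
Proof.
apply/mapP/idP => [[i _ ->]|/andP[]]; first exact: ltn_ord.
case: x => // x _ ltxm; exists (s^-1 (Ordinal ltxm))%g; first by rewrite mem_enum.
by rewrite permKV.
Qed.

Lemma dyck_path_height n (s : 'S_(n.*2.+1)) : dyck_path n (chpath s) ->
  [/\ height (oneline s) 0 = 0, height (oneline s) n.*2 = 0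
    & unit_steps (height (oneline s)) n.*2].
Proof.
set w := oneline s => Hd.
pose g i := (i%:Z%R, (height w i)%:Z%R) : int * int.
have Eg : chpath s = g 0 :: map g (iota 1 n.*2) by [].
move: Hd; rewrite Eg => /and4P[/eqP[h0] Hp /eqP Hl _]; split=> //.
  move: Hl; rewrite last_map => -[].
  have -> : last 0 (iota 1 n.*2) = n.*2.
    by rewrite -nth_last size_iota; case: (n.*2) => // k; rewrite nth_iota.
  by [].
move=> i Hi; move/(pathP (g 0)): Hp => /(_ i).
rewrite size_map size_iota => /(_ Hi).
have -> : nth (g 0) (g 0 :: map g (iota 1 n.*2)) i = g i.
  rewrite -[g 0 :: _]/(map g (iota 0 n.*2.+1)) (nth_map 0) ?size_iota ?nth_iota //; lia.
rewrite (nth_map 0) ?size_iota // nth_iota // add1n.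
by rewrite /dyck_step /g => /orP[] /eqP[_]; lia.
Qed.

Theorem theorem8 (n : nat) (s : 'S_(n.*2.+1)) (hn : 1 <= n)
    (hs : dyck_path n (chpath s)) :
  incontractible (oneline s) /\ NTmu (oneline s) = n.
Proof.
have [h0 hN hstep] := dyck_path_height n s hs.
have Us := oneline_uniq _ s; have Ss := size_oneline _ s.
have Ms := mem_oneline _ s; split.
  exact: dyck_word_incontractible Us Ss Ms h0 hN hstep.
by rewrite (NTmu_dyck_word _ _ Us Ss Ms h0 hN hstep) doubleK.
Qed.
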